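(* Let $\mathcal{B}$ be a real separable Banach space with a Schauder basis $(u_k)_{k\ge1}$, $\|u_k\|_{\mathcal{B}}=1$, and let $T(f)=(a_k)$ for $f=\lim_{n\to\infty}\sum_{k=1}^n a_ku_k\in\mathcal{B}$. Let $\{\sigma_k^2\}$ be a family of variances such that $$\sum_{k=1}^\infty\frac{\sigma_k^2}{|x_k|}<\infty$$ for some sequence $(x_k)\in\ell_1$ with all $x_k\neq0$. Let $\mu_k$ be the Gaussian measure on $\mathbb{R}$ with mean $0$ and variance $\sigma_k^2$, and define $\mu_{\mathcal{B}}(E)=\left(\bigotimes_{k=1}^\infty\mu_k\right)(T[E])$ for Borel subsets $E$ of $\mathcal{B}$. Then $\mu_{\mathcal{B}}(\mathcal{B})=1$.
   Context: A sequence $(u_k)$ with $\|u_k\|_{\mathcal B}=1$ is a Schauder basis of $\mathcal{B}$ if each $f\in\mathcal{B}$ has a unique scalar sequence $(a_k)$ with $f=\lim_{n\to\infty}\sum_{k=1}^na_ku_k$. $\bigotimes_{k}\mu_k$ is the countable product probability measure on $\mathbb{R}^\infty=\mathbb{R}^{\mathbb{N}}$. *)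

(* Defs.v *)
From HB Require Import structures.
From mathcomp Require Import all_boot all_order all_algebra.
From mathcomp Require Import all_classical all_reals all_analysis.

Set Implicit Arguments.
Unset Strict Implicit.
Unset Printing Implicit Defensive.

Import Order.TTheory GRing.Theory Num.Theory.
Import numFieldNormedType.Exports.

Local Open Scope classical_set_scope.
Local Open Scope ring_scope.

(* The library has normal_prob m 0 = uniform law on [0, 1], so the degenerate
   Gaussian measure (variance 0) is treated apart.  The argument [s] is the
   standard deviation: the variance is [s ^+ 2]. *)
Definition centered_gaussian (R : realType) (s : R) : set R -> \bar R :=
  if s == 0 then dirac (0 : R) else normal_prob 0 s.

Definition coordinate_cylinders (R : realType) : set_system (nat -> R) :=
  [set C | exists k (A : set R), measurable A /\ C = [set a | A (a k)]].

(* R^oo with its product sigma-algebra *)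
Definition Rinfty (R : realType) := g_sigma_algebraType (@coordinate_cylinders R).

(* By the pi-lambda theorem this determines P on the product sigma-algebra; it
   exists for every sequence of probability measures mu by Kolmogorov's
   extension theorem. *)
Definition is_countable_product (R : realType) (mu : nat -> set R -> \bar R)
    (P : probability (Rinfty R) R) : Prop :=
  forall (n : nat) (A : nat -> set R), (forall k, measurable (A k)) ->
    P [set a : nat -> R | forall k, (k < n)%N -> A k (a k)] =
    (\prod_(k < n) mu k (A k))%E.

Definition separable_space (T : topologicalType) : Prop :=
  exists2 D : set T, countable D & dense D.

Definition expansion (R : realType) (B : normedModType R) (u : nat -> B)
    (a : nat -> R) (f : B) : Prop :=
  series (fun k => a k *: u k) @ \oo --> f.

Definition schauder_basis (R : realType) (B : normedModType R)
    (u : nat -> B) : Prop :=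
  forall f : B, exists! a : nat -> R, expansion u a f.

Definition muB (R : realType) (B : normedModType R)
    (P : probability (Rinfty R) R) (T : B -> nat -> R) :
    set (g_sigma_algebraType (@open B)) -> \bar R :=
  fun E => P (T @` E).

(* Main.v *)
Require Import Defs.
From HB Require Import structures.
From mathcomp Require Import all_boot all_order all_algebra.
From mathcomp Require Import all_classical all_reals all_analysis.
From mathcomp Require Import measurable_realfun.
From mathcomp Require Import ring lra.
Import Order.TTheory GRing.Theory Num.Theory.
Import numFieldNormedType.Exports.
Local Open Scope classical_set_scope.
Local Open Scope ring_scope.

(** The set [T @` setT] consists of the sequences [a] for which the series of
    the [a k *: u k] converges in [B]: a convergent expansion is the expansion
    of its sum, and uniqueness identifies its coefficients with [T] of that sum
    ([range_coefficients]).  Two things remain.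

    The set is measurable in [Rinfty R] ([measurable_cvg_series]).  By
    completeness, convergence is Cauchy's criterion, a countable combination of
    bounds on norms of finite sums; these sums are Borel maps into [B] because
    [B] is separable ([borel_map_add]).

    Almost every sequence is in it.  As [`|u k| = 1], absolute convergence
    places every absolutely summable sequence in the set, so a finite
    expectation of the sum of the [`|a k|] is enough ([ae_cvg_series_norm]).
    From [`|t| <= c + t ^+ 2 / c] with [c = `|x k|], and since the second
    moment of a centered Gaussian is at most a constant times its variance
    ([second_moment_centered_gaussian]), that expectation is bounded by the sum
    of the [`|x k|] plus a multiple of the sum of the
    [sigma k ^+ 2 / `|x k|]; both are finite by hypothesis. *)

Set Implicit Arguments.
Unset Strict Implicit.
Unset Printing Implicit Defensive.

(** * Second moment of a centered Gaussian *)

(** The density of the normal law coincides almost everywhere with its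
    Radon-Nikodym derivative, for which the change of variables is known. *)
Lemma ge0_integral_normal_prob (R : realType) (m s : R) (f : R -> \bar R) :
  measurable_fun setT f -> (forall x, (0 <= f x)%E) ->
  (\int[normal_prob m s]_x f x
   = \int[lebesgue_measure]_x (f x * (normal_pdf m s x)%:E))%E.
Proof.
move=> mf f0.
have dom := @normal_prob_dominates R m s.
rewrite -(Radon_Nikodym_SigmaFinite.change_of_variables dom)//.
have mpdf : measurable_fun setT (fun x : R => (normal_pdf m s x)%:E).
  by apply/measurable_EFinP; exact: measurable_normal_pdf.
have mg := measurable_int _ (Radon_Nikodym_SigmaFinite.f_integrable dom).
apply: ae_eq_integral => //.
- exact: emeasurable_funM.
- exact: emeasurable_funM.
apply: ae_eqe_mul2l.
apply: integral_ae_eq => //.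
- exact: Radon_Nikodym_SigmaFinite.f_integrable.
- by move=> E _ mE; rewrite -Radon_Nikodym_SigmaFinite.f_integral.
Qed.

(** A quadratic factor is absorbed by doubling the standard deviation.  This
    bounds the second moment by the total mass of another normal law, which
    avoids an integration by parts on the whole line. *)
Lemma sqr_normal_pdf_le (R : realType) (s x : R) : s != 0 ->
  x ^+ 2 * normal_pdf 0 s x <= 6 * s ^+ 2 * normal_pdf 0 (2 * s) x.
Proof.
move=> s0; have s20 : 2 * s != 0 by rewrite mulf_neq0// pnatr_eq0.
have ss : 0 < s ^+ 2 by rewrite exprn_even_gt0.
rewrite /normal_pdf (negbTE s0) (negbTE s20).
have -> : normal_peak s = 2 * normal_peak (2 * s).
  rewrite /normal_peak.
  have -> : (2 * s) ^+ 2 * pi *+ 2 = 2 ^+ 2 * (s ^+ 2 * pi *+ 2) :> R by ring.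
  by rewrite sqrtrM ?sqr_ge0// sqrtr_sqr ger0_norm// invfM mulrA divff ?mul1r.
(* [y] is the difference of the two exponents, and [y <= expR y]. *)
set y := 3 * x ^+ 2 / (8 * s ^+ 2).
have y0 : 0 <= y by rewrite divr_ge0 // mulr_ge0 // sqr_ge0.
have -> : normal_fun 0 (2 * s) x = expR y * normal_fun 0 s x.
  rewrite /normal_fun -expRD; congr expR; rewrite /y.
  by field.
have xe : x ^+ 2 <= 3 * s ^+ 2 * expR y.
  have -> : x ^+ 2 = 8 / 3 * s ^+ 2 * y by rewrite /y; field.
  apply: ler_pM => //; first by rewrite mulr_ge0 // sqr_ge0.
    by apply: ler_wpM2r; [exact: sqr_ge0|lra].
  by apply: le_trans (expR_ge1Dx y); rewrite lerDr.
have p0 := normal_peak_ge0 (2 * s).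
have f0 := normal_fun_ge0 0 s x.
have := ler_wpM2r (mulr_ge0 p0 f0) xe.
by nra.
Qed.

(** The exact value is [s ^+ 2]; an upper bound by any constant multiple
    of it serves equally well for summability. *)
Lemma second_moment_centered_gaussian (R : realType) (s : R)
    (Q : {measure set (measurableTypeR R) -> \bar R}) :
  (forall A, measurable A -> Q A = centered_gaussian s A) ->
  (\int[Q]_x (x ^+ 2)%:E <= (6 * s ^+ 2)%:E)%E.
Proof.
rewrite /centered_gaussian => QE.
have mX2 : measurable_fun setT (fun x : R => (x ^+ 2)%:E).
  by apply/measurable_EFinP; exact: measurable_funX.
have [s0|s0] := eqVneq s 0.
  rewrite (eq_measure_integral (dirac (0 : measurableTypeR R)))
    => [|A mA _]; last first.
    by rewrite QE// s0 eqxx.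
  by rewrite integral_dirac//= diracT mul1e s0 !expr0n/= mulr0.
rewrite (eq_measure_integral (normal_prob 0 s)) => [|A mA _]; last first.
  by rewrite QE// (negbTE s0).
rewrite ge0_integral_normal_prob//; last by move=> x; rewrite lee_fin sqr_ge0.
apply: (@le_trans _ _ (\int[lebesgue_measure]_x
    ((6 * s ^+ 2)%:E * (normal_pdf 0 (2 * s) x)%:E)))%E.
  apply: ge0_le_integral => //.
  - by move=> x _; rewrite mule_ge0 ?lee_fin ?sqr_ge0 ?normal_pdf_ge0.
  - apply: emeasurable_funM => //.
    by apply/measurable_EFinP; exact: measurable_normal_pdf.
  - apply: emeasurable_funM => //.
    by apply/measurable_EFinP; exact: measurable_normal_pdf.
  - by move=> x _; rewrite -!EFinM lee_fin sqr_normal_pdf_le.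
rewrite ge0_integralZl//; last 3 first.
- by apply/measurable_EFinP; exact: measurable_normal_pdf.
- by move=> x _; rewrite lee_fin normal_pdf_ge0.
- by rewrite lee_fin mulr_ge0 ?sqr_ge0.
by rewrite integral_normal_pdf mule1.
Qed.

(** * Measurability of the convergence of a series in a separable space *)

(** Measurability for the Borel sigma-algebra of [B], tested on its generators
    so that [B] itself needs no structure of measurable type. *)
Definition borel_map d (W : measurableType d) (B : topologicalType)
  (F : W -> B) := forall U, open U -> measurable (F @^-1` U).

Lemma separable_enum (B : topologicalType) (b : B) : separable_space B ->
  exists e : nat -> B, dense (range e).
Proof.
case=> D cD dD.
have D0 : D !=set0.
  by have [x []] := dD _ (ex_intro _ b I) openT; exists x.
have /pfcard_geP[DE|[f]] := cD; first by move: D0; rewrite DE => -[].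
exists f; suff -> : range f = D by [].
exact: image_eq.
Qed.

(** For a general normed space the preimage of an open set under the addition
    of [B * B] need not belong to the product of the Borel sigma-algebras.  With
    a dense sequence [e] it is a countable union of products of balls. *)
Lemma borel_map_add d (W : measurableType d) (R : realType)
    (B : normedModType R) (F G : W -> B) : separable_space B ->
  borel_map F -> borel_map G ->
  borel_map (fun w => F w + G w).
Proof.
move=> /(separable_enum 0)[e de] mF mG U oU.
pose r n : R := n.+1%:R^-1.
(* The indices for which the sum of the two balls stays inside [U]. *)
pose ok i j n := forall v w,
  ball (e i) (r n) v -> ball (e j) (r n) w -> U (v + w).
pose C i j n := F @^-1` ball (e i) (r n) `&` G @^-1` ball (e j) (r n).
have -> : (fun w => F w + G w) @^-1` U =
    \bigcup_i \bigcup_j \bigcup_(n in [set n | ok i j n]) C i j n.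
  apply/seteqP; split => [w Uw|w [i _ [j _ [n okn [Fw Gw]]]]]; last exact: okn.
  have /nbhs_ballP[eps /= eps0 sU] := open_nbhs_nbhs (conj oU Uw).
  (* Two points of one ball of radius [r n] are less than [2 * r n] apart, and
     this distance enters once for [F] and once for [G]. *)
  have [n nP] : exists n, r n < eps / 4.
    have e4 : 0 < eps / 4 by rewrite divr_gt0.
    have [n _ /(_ n (leqnn n)) /= H] := near_infty_natSinv_lt (PosNum e4).
    by exists n.
  have near_e v : exists i, ball (e i) (r n) v.
    have r0 : 0 < r n by rewrite invr_gt0.
    have [x [bx [i _ ix]]] := de (ball v (r n)) (ex_intro _ v (ballxx v r0))
       (ball_open v (r n)).
    by exists i; rewrite ix; exact: ball_sym.
  have [i Fi] := near_e (F w); have [j Gj] := near_e (G w).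
  exists i => //; exists j => //; exists n => // v v' bv bv'.
  apply: sU; move: Fi Gj bv bv'; rewrite -!ball_normE /= => Fi Gj bv bv'.
  have -> : F w + G w - (v + v') =
      ((e i - v) - (e i - F w)) + ((e j - v') - (e j - G w)).
    have sh (a b c : B) : a - b - (a - c) = c - b.
      by rewrite opprB addrC addrA subrK.
    by rewrite !sh opprD addrACA.
  have h1 := ler_normD (e i - v - (e i - F w)) (e j - v' - (e j - G w)).
  have h2 := ler_normB (e i - v) (e i - F w).
  have h3 := ler_normB (e j - v') (e j - G w).
  lra.
apply: bigcupT_measurable => i; apply: bigcupT_measurable => j.
apply: bigcup_measurable => n _.
by apply: measurableI; [apply: mF|apply: mG]; exact: ball_open.
Qed.

Lemma borel_map_scale d (W : measurableType d) (R : realType)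
    (B : normedModType R) (g : W -> R) (v : B) :
  measurable_fun setT g -> borel_map (fun w => g w *: v).
Proof.
move=> mg U oU; rewrite -[X in measurable X]setTI.
apply: (mg measurableT ((fun t : R => t *: v) @^-1` U)).
apply: open_measurable; apply: open_comp => // t _.
exact: scalel_continuous.
Qed.

Lemma borel_map_sum d (W : measurableType d) (R : realType)
    (B : normedModType R) (F : nat -> W -> B) n m : separable_space B ->
  (forall k, borel_map (F k)) ->
  borel_map (fun w => \sum_(n <= k < m) F k w).
Proof.
move=> sB mF; elim: (index_iota n m) => [|k s IH].
  under eq_fun do rewrite big_nil.
  by move=> U oU; rewrite preimage_cst; case: ifP.
under eq_fun do rewrite big_cons.
exact: borel_map_add.
Qed.

(** The limit is not available as a measurable function beforehand, hence
    Cauchy's criterion, with radii [j.+1%:R^-1] to keep it countable. *)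
Lemma measurable_cvg_series d (W : measurableType d) (R : realType)
    (B : completeNormedModType R) (F : nat -> W -> B) : separable_space B ->
  (forall k, borel_map (F k)) ->
  measurable [set w | cvgn (series (fun k => F k w))].
Proof.
move=> sB mF.
pose C j n m := [set w | `|\sum_(n <= k < m) F k w| < j.+1%:R^-1].
have -> : [set w | cvgn (series (fun k => F k w))] =
    \bigcap_j \bigcup_N \bigcap_(n in [set n | (N <= n)%N])
       \bigcap_(m in [set m | (N <= m)%N]) C j n m.
  apply/seteqP; split=> w /=.
    move=> /cauchy_cvgP/cauchy_seriesP cF j _.
    have j0 : 0 < j.+1%:R^-1 :> R by rewrite invr_gt0.
    have [[P Q] /= [[N _ NP] [M _ MQ]] PQ] := cF _ j0.
    exists (maxn N M) => // n /=; rewrite geq_max => /andP[Nn _] m /=.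
    rewrite geq_max => /andP[_ Mm].
    by apply: (PQ (n, m)); split; [exact: NP|exact: MQ].
  move=> H; apply/cauchy_cvgP/cauchy_seriesP => eps eps0.
  have [j _ /(_ j (leqnn j)) /= je] := near_infty_natSinv_lt (PosNum eps0).
  have [N _ NH] := H j I.
  exists ([set n | (N <= n)%N], [set n | (N <= n)%N]).
    by split; exists N.
  move=> [n m] /= [Nn Nm]; exact: lt_trans (NH n Nn m Nm) je.
apply: bigcapT_measurable => j; apply: bigcupT_measurable => N.
apply: bigcap_measurable => [|n _]; first by exists N => /=.
apply: bigcap_measurable => [|m _]; first by exists N => /=.
have -> : C j n m = (fun w => \sum_(n <= k < m) F k w) @^-1` ball 0 j.+1%:R^-1.
  by apply/seteqP; split => w; rewrite /C /= -ball_normE /= sub0r normrN.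
by apply: borel_map_sum => //; exact: ball_open.
Qed.

(** * The coordinates of a countable product of measures *)

(** The codomain is [measurableTypeR R], the measurable type that carries the
    Lebesgue measure, so that the distribution of a coordinate can be compared
    with [normal_prob]. *)
Definition coordinate (R : realType) (k : nat) (a : Rinfty R) :
  measurableTypeR R := a k.

Lemma measurable_coordinate (R : realType) (k : nat) :
  measurable_fun setT (@coordinate R k).
Proof.
move=> _ A mA; rewrite setTI.
by apply: sub_sigma_algebra; exists k, A.
Qed.

HB.instance Definition _ (R : realType) (k : nat) :=
  isMeasurableFun.Build _ _ _ _ (@coordinate R k) (@measurable_coordinate R k).

Lemma centered_gaussian_setT (R : realType) (s : R) :
  centered_gaussian s setT = 1%E.
Proof.
rewrite /centered_gaussian; case: ifP => _; first by rewrite diracT.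
exact: integral_normal_pdf.
Qed.

Lemma countable_product_marginal (R : realType)
    (mu : nat -> set R -> \bar R) (P : probability (Rinfty R) R) k (A : set R) :
  is_countable_product mu P -> (forall j, mu j setT = 1%E) -> measurable A ->
  P [set a : nat -> R | A (a k)] = mu k A.
Proof.
move=> hP mu1 mA.
(* The cylinder over [A] is the box with all earlier factors equal to [setT]. *)
pose C j : set R := if j == k then A else setT.
have -> : [set a : nat -> R | A (a k)] =
    [set a : nat -> R | forall j, (j < k.+1)%N -> C j (a j)].
  apply/seteqP; split => a /=.
    by move=> Aak j _; rewrite /C; case: eqP => // ->.
  by move=> /(_ k (ltnSn k)); rewrite /C eqxx.
rewrite hP; last by move=> j; rewrite /C; case: ifP.
rewrite big_ord_recr /= big1 ?mul1e; first by rewrite /C eqxx.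
by move=> i _; rewrite /C ltn_eqF.
Qed.

(** * Almost sure absolute convergence *)

(** By monotone convergence the sum of the norms has a finite integral, hence
    is finite almost everywhere. *)
Lemma ae_cvg_series_norm d (W : measurableType d) (R : realType)
    (mu : {measure set W -> \bar R}) (X : nat -> W -> R) :
  (forall k, measurable_fun setT (X k)) ->
  (\sum_(0 <= k <oo) \int[mu]_w `|X k w|%:E < +oo)%E ->
  {ae mu, forall w, cvgn (series (fun k => `|X k w|))}.
Proof.
move=> mX sX.
pose S w := (\sum_(0 <= k <oo) `|X k w|%:E)%E.
have mXE k : measurable_fun setT (fun w => `|X k w|%:E).
  by apply/measurable_EFinP; exact: measurableT_comp.
have S0 w : (0 <= S w)%E by apply: nneseries_ge0.
have intS : mu.-integrable setT S.
  apply/integrableP; split; first exact: ge0_emeasurable_sum.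
  under eq_integral do rewrite gee0_abs//.
  by rewrite integral_nneseries.
apply: filterS (integrable_ae measurableT intS) => w /(_ I) Sfin.
apply: nondecreasing_is_cvgn; first exact: nondecreasing_series.
exists (fine (S w)) => _ [n _ <-].
rewrite -lee_fin fineK// -sumEFin; exact: nneseries_lim_ge.
Qed.

Lemma norm_le_add_sqr_div (R : realFieldType) (a c : R) : 0 < c ->
  `|a| <= c + a ^+ 2 / c.
Proof.
move=> c0; rewrite -(ler_pM2r c0) mulrDl divfK ?gt_eqF//.
rewrite -(real_normK (num_real a)).
by have := normr_ge0 a; nra.
Qed.

(** Bounding the first moment by [v / c], rather than by the square root of
    [v], gives directly the terms of the two series of the theorem. *)
Lemma expectation_norm_le d (W : measurableType d) (R : realType)
    (P : probability W R) (X : W -> R) (v c : R) :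
  measurable_fun setT X -> 0 < c ->
  (\int[P]_w (X w ^+ 2)%:E <= v%:E)%E ->
  (\int[P]_w `|X w|%:E <= (c + v / c)%:E)%E.
Proof.
move=> mX c0 EX2.
have mX2 : measurable_fun setT (fun w => (X w ^+ 2)%:E).
  by apply/measurable_EFinP; exact: measurable_funX.
have c0' : (0 <= (c^-1)%:E)%E by rewrite lee_fin invr_ge0 ltW.
apply: (@le_trans _ _ (\int[P]_w (c%:E + (c^-1)%:E * (X w ^+ 2)%:E)))%E.
  apply: ge0_le_integral => //.
  - by apply/measurable_EFinP; exact: measurableT_comp.
  - by apply: emeasurable_funD => //; exact: emeasurable_funM.
  - move=> w _; rewrite -EFinM -EFinD lee_fin mulrC.
    exact: norm_le_add_sqr_div.
rewrite ge0_integralD//; last 3 first.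
- by move=> w _; rewrite lee_fin ltW.
- by move=> w _; rewrite mule_ge0// lee_fin sqr_ge0.
- exact: emeasurable_funM.
rewrite integral_cst// [X in (_ * X)%E](@probability_setT _ W R P) mule1.
rewrite ge0_integralZl//; last first.
  by move=> w _; rewrite lee_fin sqr_ge0.
by rewrite EFinD mulrC EFinM leeD2l// lee_wpmul2l.
Qed.

(** * The range of the coefficient map *)

Lemma range_coefficients (R : realType) (B : normedModType R) (u : nat -> B)
    (T : B -> nat -> R) : schauder_basis u -> (forall f, expansion u (T f) f) ->
  T @` setT = [set a | cvgn (series (fun k => a k *: u k))].
Proof.
move=> hu hT; apply/seteqP; split => [_ [f _ <-]|a /= ca].
  by apply/cvg_ex; exists f; exact: hT.
set f := limn (series (fun k => a k *: u k)).
exists f => //; have [b [_ bP]] := hu f.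
by rewrite -(bP (T f) (hT f)); exact: bP.
Qed.

Unset Implicit Arguments.

Theorem theorem2p28 (R : realType) (B : completeNormedModType R)
  (hsep : separable_space B)
  (u : nat -> B) (hu1 : forall k, `|u k| = 1) (hu : schauder_basis u)
  (T : B -> nat -> R) (hT : forall f, expansion u (T f) f)
  (sigma : nat -> R)
  (hsigma : exists x : nat -> R,
     [/\ (\sum_(0 <= k <oo) `|x k|%:E < +oo)%E,
         (forall k, x k != 0) &
         (\sum_(0 <= k <oo) (sigma k ^+ 2 / `|x k|)%:E < +oo)%E])
  (P : probability (Rinfty R) R)
  (hP : is_countable_product (fun k => centered_gaussian (sigma k)) P) :
  muB P T setT = 1%E.
Proof.
have [x [sx x0 ssx]] := hsigma.
have x_gt0 k : 0 < `|x k| by rewrite normr_gt0.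
pose coord k (a : Rinfty R) : R := a k.
have mcoord k : measurable_fun setT (coord k) by exact: measurable_coordinate.
have E_coord2 k : (\int[P]_a (coord k a ^+ 2)%:E <= (6 * sigma k ^+ 2)%:E)%E.
  have <- : (\int[distribution P (@coordinate R k)]_t (t ^+ 2)%:E =
      \int[P]_a (coord k a ^+ 2)%:E)%E.
    rewrite ge0_integral_distribution//.
      by apply/measurable_EFinP; exact: measurable_funX.
    by move=> t; rewrite lee_fin sqr_ge0.
  apply: (@second_moment_centered_gaussian R (sigma k)
    (distribution P (@coordinate R k))) => A mA.
  apply: (countable_product_marginal k hP) => // j.
  exact: centered_gaussian_setT.
have E_coord k : (\int[P]_a `|coord k a|%:E <=
    `|x k|%:E + 6%:E * (sigma k ^+ 2 / `|x k|)%:E)%E.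
  by rewrite -EFinM mulrA -EFinD; exact: expectation_norm_le.
have sumE : (\sum_(0 <= k <oo) \int[P]_a `|coord k a|%:E < +oo)%E.
  apply: (@le_lt_trans _ _ (\sum_(0 <= k <oo)
      (`|x k|%:E + 6%:E * (sigma k ^+ 2 / `|x k|)%:E)))%E.
    apply: lee_nneseries => [k _ _|k _]; first exact: integral_ge0.
    exact: E_coord.
  rewrite nneseriesD; last 2 first.
  - by [].
  - by move=> k _ _; rewrite mule_ge0// lee_fin divr_ge0// sqr_ge0.
  rewrite nneseriesZl; last by move=> k _; rewrite lee_fin divr_ge0// sqr_ge0.
  by rewrite lte_add_pinfty// lte_mul_pinfty.
have ae_l1 := ae_cvg_series_norm mcoord sumE.
rewrite /muB (range_coefficients hu hT).
set C := [set a | _].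
(* [P] is additive on measurable sets only, so the complement can be used
   once [C] is known to be measurable. *)
have mC : measurable (C : set (Rinfty R)).
  apply: measurable_cvg_series => // k.
  exact: borel_map_scale (mcoord k).
rewrite -[C]setCK probability_setC; last exact: measurableC.
rewrite (_ : P (~` C) = 0%E) ?sube0//.
apply/negligibleP; first exact: measurableC.
apply: filterS ae_l1 => a ca.
apply: normed_cvg; apply: (eq_ind _ (fun s => cvgn (series s)) ca).
by apply/funext => k; rewrite /= normrZ hu1 mulr1.
Qed.
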